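(* Let $\beta>0$ and let $N\ge 2$ and $k\geq 2$ be integers. Then $$\mathbb{E}\big[ Z_N(\beta)^k \big] = \exp\Big\{\frac{\beta^2 k}{4} N - \frac{\beta^2 k^2}{4}\Big\}\, \mathbb{E} \Big[ Z_k\Big(\beta \sqrt{\tfrac{k}{N}}\Big)^N \Big].$$ Equivalently (for all such $\beta, N, k$), $$\mathbb{E} \Big[ \Big(\mathrm{e}^{\frac{\beta^2}{4}} Z_N\Big(\frac{\beta}{\sqrt{k}}\Big)\Big)^k \Big] = \mathbb{E} \Big[ \Big(\mathrm{e}^{\frac{\beta^2}{4}} Z_k\Big(\frac{\beta}{\sqrt{N}}\Big)\Big)^N\Big].$$
   Context: For an integer $M\ge 2$ and a real parameter $\gamma>0$, the partition function of the Sherrington-Kirkpatrick model is the random variable $$Z_M(\gamma) := \sum_{\sigma \in \{-1, 1\}^M} \exp \Big\{ \frac{\gamma}{\sqrt{M}} \sum_{1 \leq i < j \leq M} g_{i j} \sigma_i \sigma_j \Big\},$$ where $g_{ij}$, $1\le i<j\le M$, are independent standard normal random variables and $\sigma=(\sigma_1,\dots,\sigma_M)$. $\mathbb{E}$ denotes expectation over the $g_{ij}$. *)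

(* Defs.v *)
From HB Require Import structures.
From mathcomp Require Import all_boot all_order all_algebra.
From mathcomp Require Import all_classical all_reals all_analysis.

Set Implicit Arguments.
Unset Strict Implicit.
Unset Printing Implicit Defensive.

Import Order.TTheory GRing.Theory Num.Theory.
Import numFieldNormedType.Exports.

Local Open Scope classical_set_scope.
Local Open Scope ring_scope.

(* Mutual independence of the subfamily (X i)_{i in J}: the product rule is
   required for every subset K of J, in terms of the joint events
   { X i \in B i for all i \in K }. *)
Definition mutually_independent (d : measure_display) (T : measurableType d)
    (R : realType) (P : probability T R) (I : finType) (J : {set I})
    (X : I -> {RV P >-> R}) : Prop :=
  forall (K : {set I}) (B : I -> set R),
    K \subset J ->
    (forall i, measurable (B i)) ->
    P [set w | forall i, i \in K -> B i (X i w)] =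
      (\prod_(i in K) P (X i @^-1` B i))%E.

(* [normal_prob m s] takes the standard deviation [s], not the variance. *)
Definition standard_normal (d : measure_display) (T : measurableType d)
    (R : realType) (P : probability T R) (X : {RV P >-> R}) : Prop :=
  forall B : set R, measurable B -> distribution P X B = normal_prob 0 1 B.

Definition upper_pairs (M : nat) : {set 'I_M * 'I_M} :=
  [set p : 'I_M * 'I_M | (p.1 < p.2)%N].

(* Couplings are indexed by all of 'I_M * 'I_M (indices start at 0), but only
   the entries g (i, j) with i < j are constrained here and used below. *)
Definition gaussian_couplings (d : measure_display) (T : measurableType d)
    (R : realType) (P : probability T R) (M : nat)
    (g : 'I_M * 'I_M -> {RV P >-> R}) : Prop :=
  mutually_independent (upper_pairs M) g /\
  (forall p, p \in upper_pairs M -> standard_normal (g p)).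

(* A configuration in {-1, 1}^M is encoded by a boolean vector [s]: the i-th
   spin is (-1) ^+ s i, that is, 1 if s i = false and -1 if s i = true. *)
Definition spin (R : realType) (M : nat) (s : {ffun 'I_M -> bool})
    (i : 'I_M) : R := (-1) ^+ s i.

Definition partition_function (d : measure_display) (T : measurableType d)
    (R : realType) (P : probability T R) (M : nat)
    (g : 'I_M * 'I_M -> {RV P >-> R}) (gamma : R) (w : T) : R :=
  \sum_(s : {ffun 'I_M -> bool})
    expR (gamma / Num.sqrt M%:R *
          \sum_(i < M) \sum_(j < M | (i < j)%N)
            g (i, j) w * spin R s i * spin R s j).

(* Main.v *)
(* [Z_M(gamma) ^ n] is a sum over [n] replicas of exponentials of linear forms in
   the couplings. Integrating out the Gaussians leaves the exponential of
   [gamma^2 / (4 M)] times [sum_(i, j) (sum_l s_l(i) s_l(j))^2 - M n^2]. With [A]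
   the [n x M] matrix of spins, the double sum is the squared Frobenius norm of
   [A^T A], hence also that of [A A^T]: transposing [A] exchanges the roles of
   [M] and [n]. *)
Require Import Defs.
From HB Require Import structures.
From mathcomp Require Import all_boot all_order all_algebra.
From mathcomp Require Import all_classical all_reals all_analysis measurable_realfun.
From mathcomp Require Import ring.

Import Order.TTheory GRing.Theory Num.Theory.
Import numFieldNormedType.Exports.

Local Open Scope ring_scope.

(** * Change of variables for weighted measures *)

Section weighted_image.
Local Open Scope classical_set_scope.
Local Open Scope ereal_scope.
Import HBNNSimple.

(** The last hypothesis makes [c] times [nu] the image under [phi] of [mu] weighted by [h]. For
    simple [f] the claim is a linear combination of this hypothesis over the level sets of [f];
    monotone convergence on both sides gives the general case. *)
Lemma ge0_integral_weighted_image {d1 d2 : measure_display}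
    {X : measurableType d1} {Y : measurableType d2} {R : realType}
    (mu : {measure set X -> \bar R}) (nu : {measure set Y -> \bar R})
    {phi : X -> Y} {h : X -> R} {c : R} {f : Y -> R} :
  measurable_fun [set: X] phi -> measurable_fun [set: X] h ->
  measurable_fun [set: Y] f ->
  (forall x, (0 <= h x)%R) -> (0 <= c)%R -> (forall y, (0 <= f y)%R) ->
  (forall B, measurable B ->
    \int[mu]_(x in phi @^-1` B) (h x)%:E = c%:E * nu B) ->
  \int[mu]_x (h x * f (phi x))%:E = c%:E * \int[nu]_y (f y)%:E.
Proof.
move=> mphi mh mf h0 c0 f0 hnu.
have mF : measurable_fun [set: Y] (fun y => (f y)%:E) by exact/measurable_EFinP.
pose f_ := nnsfun_approx measurableT mF.
have f_cvg y : (f_ n y)%:E @[n --> \oo] --> (f y)%:E.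
  by apply: (cvg_nnsfun_approx _ mF) => // z _; rewrite lee_fin.
have f_nd y m n : (m <= n)%N -> (f_ m y <= f_ n y)%R.
  by move=> mn; exact/lefP/nd_nnsfun_approx.
have f_phi n : measurable_fun [set: X] (fun x => f_ n (phi x)).
  exact: measurableT_comp.
have simple_case n : \int[mu]_x (h x * f_ n (phi x))%:E =
    c%:E * \int[nu]_y (f_ n y)%:E.
  rewrite integralT_nnsfun sintegralE.
  transitivity (\int[mu]_x (\sum_(r \in range (f_ n))
      (r * \1_(f_ n @^-1` [set r]) (phi x))%:E * (h x)%:E)).
    apply: eq_integral => x _.
    rewrite -ge0_mule_fsuml => [|r]; last exact: nnfun_muleindic_ge0.
    by rewrite fsumEFin// -(fimfunE _ (phi x)) muleC.
  have mset r : measurable (f_ n @^-1` [set r]) by exact: measurable_sfunP.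
  have mind r : measurable_fun [set: X]
      (fun x => (\1_(f_ n @^-1` [set r]) (phi x) : R)).
    by apply: (measurableT_comp _ mphi); exact: measurable_indic.
  rewrite ge0_integral_fsum//; last 2 first.
  - move=> r; apply/measurable_EFinP; apply: measurable_funM => //.
    exact: measurable_funM.
  - by move=> r x _; rewrite mule_ge0 ?lee_fin//; exact: nnfun_muleindic_ge0.
  have h_ind r : (fun x => (h x)%:E) \_ (phi @^-1` (f_ n @^-1` [set r])) =
      (fun x => (\1_(f_ n @^-1` [set r]) (phi x) * h x)%:E).
    by apply/funext => x; rewrite epatch_indic/= -EFinM mulrC.
  rewrite ge0_mule_fsumr; last first.
    by move=> r; exact: nnsfun_mulemu_ge0.
  (* Taking [r] in the range of [f_ n] makes it nonnegative, so that it can be pulled out of the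
     integral. *)
  apply: eq_fsbigr => _ /set_mem[y _ <-].
  set r := f_ n y.
  rewrite muleCA -hnu// [in RHS]integral_mkcond h_ind.
  rewrite -ge0_integralZl_EFin//; last 2 first.
  - by move=> x _; rewrite lee_fin mulr_ge0.
  - by apply/measurable_EFinP; exact: measurable_funM.
  by apply: eq_integral => x _; rewrite -!EFinM mulrA.
have L : (\int[mu]_x (h x * f_ n (phi x))%:E) @[n --> \oo] -->
    \int[mu]_x (h x * f (phi x))%:E.
  rewrite (_ : \int[mu]_x _ =
      \int[mu]_x limn (fun n => (h x * f_ n (phi x))%:E)); last first.
    apply: eq_integral => x _; apply/esym/cvg_lim => //.
    under eq_fun do rewrite EFinM.
    by rewrite EFinM; apply: cvgeZl => //; exact: f_cvg.
  apply: cvg_monotone_convergence => //.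
  - by move=> n; apply/measurable_EFinP; exact: measurable_funM.
  - by move=> n x _; rewrite lee_fin mulr_ge0.
  - by move=> x _ m n mn; rewrite lee_fin ler_wpM2l// f_nd.
have U : (\int[nu]_y (f_ n y)%:E) @[n --> \oo] --> \int[nu]_y (f y)%:E.
  rewrite (_ : \int[nu]_y _ = \int[nu]_y limn (fun n => (f_ n y)%:E)); last first.
    by apply: eq_integral => y _; apply/esym/cvg_lim => //; exact: f_cvg.
  apply: cvg_monotone_convergence => //.
  - by move=> n; apply/measurable_EFinP.
  - by move=> n x _; rewrite lee_fin.
  - by move=> x _ m n mn; rewrite lee_fin f_nd.
move: L; rewrite (funext simple_case) => L.
by apply: (cvg_unique _ L) => //; exact: cvgeZl.
Qed.

End weighted_image.

(** * Products of functions of independent variables *)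

Section independence.
Local Open Scope classical_set_scope.
Local Open Scope ereal_scope.

Lemma measurable_joint_event {d : measure_display} {T : measurableType d}
    {R : realType} {P : probability T R} {I : finType} (X : I -> {RV P >-> R})
    (K : {set I}) (B : I -> set R) :
  (forall i, measurable (B i)) ->
  measurable [set w | forall i, i \in K -> B i (X i w)].
Proof.
move=> mB.
rewrite (_ : [set _ | _] = \bigcap_(i in [set` K]) (X i @^-1` B i)) //.
by apply: fin_bigcap_measurable => // i _; exact: measurable_sfunP.
Qed.

(* Induction on [s]: moving an index from the product into the event [K] turns
   the claim for [i :: s] into the hypothesis of
   [ge0_integral_weighted_image] for the law of [X i]. *)
Lemma independent_integral_prod_event {d : measure_display}
    {T : measurableType d} {R : realType} {P : probability T R} {I : finType}
    {J : {set I}} {X : I -> {RV P >-> R}} {f : I -> R -> R} {m : I -> R} :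
  mutually_independent J X ->
  (forall i, measurable_fun [set: R] (f i)) ->
  (forall i x, (0 <= f i x)%R) ->
  (forall i, i \in J -> \int[P]_w (f i (X i w))%:E = (m i)%:E) ->
  forall (s : seq I) (K : {set I}) (B : I -> set R),
    uniq s -> {subset s <= J :\: K} -> K \subset J ->
    (forall i, measurable (B i)) ->
  \int[P]_(w in [set w | forall i, i \in K -> B i (X i w)])
     (\prod_(i <- s) f i (X i w))%:E =
  (\prod_(i <- s) m i)%:E * P [set w | forall i, i \in K -> B i (X i w)].
Proof.
move=> indep mf f0 fm; elim=> [|i s IHs] K B.
  move=> _ _ KJ mB; under eq_integral do rewrite big_nil.
  rewrite big_nil integral_cst ?mul1e//; exact: measurable_joint_event.
move=> /= /andP[i_s us] sJK KJ mB.
have iJK : i \in J :\: K by apply: sJK; rewrite mem_head.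
have [iJ iK] : i \in J /\ i \notin K by move: iJK; rewrite inE => /andP[].
set E := [set w | _].
have mE : measurable E by exact: measurable_joint_event.
have m_ge0 j : j \in J -> (0 <= m j)%R.
  by move=> jJ; rewrite -lee_fin -fm//; apply: integral_ge0 => w _; rewrite lee_fin.
have mprod : measurable_fun [set: T] (fun w => \prod_(j <- s) f j (X j w))%R.
  by apply: measurable_prod => j _; exact: measurableT_comp.
have s_ge0 : (0 <= \prod_(j <- s) m j)%R.
  rewrite big_seq; apply: prodr_ge0 => j js; apply: m_ge0.
  have : j \in J :\: K by apply: sJK; rewrite inE js orbT.
  by rewrite inE => /andP[].
have PE_ge0 : (0 <= fine (P E))%R by rewrite fine_ge0.
have PE_fin : (fine (P E))%:E = P E by rewrite fineK ?fin_num_measure.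
rewrite integral_mkcond.
pose h w := (\prod_(j <- s) f j (X j w) * \1_E w)%R.
transitivity (\int[P]_w (h w * f i (X i w))%:E).
  apply: eq_integral => w _; rewrite epatch_indic/= -EFinM big_cons /h.
  by congr EFin; ring.
(* The constant [c] has to be the total mass of the weight [h]: the product of the remaining [m j]
   times the probability of [E]. *)
rewrite (ge0_integral_weighted_image P (distribution P (X i))
  (c := (\prod_(j <- s) m j * fine (P E))%R) (phi := X i) (h := h) (f := f i));
  last 7 first.
- exact: measurable_funPT.
- by apply: measurable_funM => //; exact: measurable_indic.
- by [].
- by move=> w; rewrite mulr_ge0// prodr_ge0.
- exact: mulr_ge0.
- by [].
- move=> A mA.
  (* Since [i] is not in [K], the set [B i] does not constrain [E] and can be replaced by [A]. *)
  pose B' j := if j == i then A else B j.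
  have mB' j : measurable (B' j) by rewrite /B'; case: ifP.
  pose E' := [set w | forall j, j \in i |: K -> B' j (X j w)].
  have E'E : E' = X i @^-1` A `&` E.
    apply/seteqP; split=> [w E'w|w [Aw Ew] j].
      split; first by have := E'w i; rewrite /B' eqxx setU11; exact.
      move=> j jK; have := E'w j; rewrite /B' finset.in_setU1 jK orbT.
      by case: eqP => [ji|_]; [move: iK; rewrite -ji jK|exact].
    by rewrite /B' finset.in_setU1; case: eqP => [-> _|_ /= jK]; [exact: Aw|exact: Ew].
  have iKJ : i |: K \subset J by rewrite finset.subUset finset.sub1set iJ.
  transitivity (\int[P]_(w in E') (\prod_(j <- s) f j (X j w))%:E).
    rewrite E'E integral_mkcondr; apply: eq_integral => w _.
    by rewrite epatch_indic/= -EFinM.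
  rewrite IHs//; last first.
    move=> j js; have : j \in J :\: K by apply: sJK; rewrite inE js orbT.
    rewrite !inE negb_or => /andP[-> ->]; rewrite !andbT.
    by apply: contraNneq i_s => <-.
  rewrite EFinM PE_fin -muleA; congr (_ * _).
  (* The product rules over [i |: K] and over [K] differ by the single factor for [X i] in [A]. *)
  rewrite !indep// big_setU1//= {1}/B' eqxx muleC; congr (_ * _).
  apply: eq_bigr => j jK; rewrite /B'; case: eqP => // ji.
  by move: iK; rewrite -ji jK.
rewrite ge0_integral_distribution; last 2 first.
- exact/measurable_EFinP.
- by move=> y; rewrite lee_fin.
by rewrite /comp fm// -PE_fin -!EFinM big_cons; congr EFin; ring.
Qed.

Lemma independent_integral_prod {d : measure_display}
    {T : measurableType d} {R : realType} {P : probability T R} {I : finType}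
    {J : {set I}} {X : I -> {RV P >-> R}} {f : I -> R -> R} {m : I -> R} :
  mutually_independent J X ->
  (forall i, measurable_fun [set: R] (f i)) ->
  (forall i x, (0 <= f i x)%R) ->
  (forall i, i \in J -> \int[P]_w (f i (X i w))%:E = (m i)%:E) ->
  \int[P]_w (\prod_(i in J) f i (X i w))%:E = (\prod_(i in J) m i)%:E.
Proof.
move=> indep mf f0 fm.
(* With no index in [K] the event is the whole space, of probability 1. *)
have := independent_integral_prod_event indep mf f0 fm (enum J) finset.set0
  (fun=> setT).
rewrite (_ : [set w | _] = setT); last first.
  by apply/seteqP; split=> // w _ i; rewrite inE.
rewrite enum_uniq finset.sub0set probability_setT mule1 big_enum => <- //.
  by apply: eq_integral => w _; rewrite big_enum.
by move=> i; rewrite mem_enum !inE.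
Qed.

End independence.

(** * Exponential moments of Gaussian sums *)

Section gaussian.
Local Open Scope classical_set_scope.
Local Open Scope ereal_scope.

(* Completing the square: [expR (a * x)] times the standard density is
   [expR (a ^+ 2 / 2)] times the density of mean [a]. *)
Lemma standard_normal_mgf {d : measure_display} {T : measurableType d}
    {R : realType} {P : probability T R} {X : {RV P >-> R}} (a : R) :
  standard_normal X ->
  \int[P]_w (expR (a * X w))%:E = (expR (a ^+ 2 / 2))%:E.
Proof.
move=> stdX.
have mexp : measurable_fun [set: R] (fun x => expR (a * x)).
  by apply: measurableT_comp => //; exact: measurable_funM.
have -> : \int[P]_w (expR (a * X w))%:E =
    \int[distribution P X]_x (expR (a * x))%:E.
  by rewrite ge0_integral_distribution//; exact/measurable_EFinP.
(* With the identity as [phi], the normal density as weight and [c = 1], the integral against the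
   law of [X] becomes a Lebesgue integral. [idR] only changes the type that carries the
   sigma-algebra. *)
pose idR (x : measurableTypeR R) : R := x.
rewrite -[LHS]mul1e -(ge0_integral_weighted_image lebesgue_measure _
  (phi := idR) (h := normal_pdf 0 1)); last 7 first.
- exact: measurable_id.
- exact: measurable_normal_pdf.
- exact: mexp.
- by move=> x; exact: normal_pdf_ge0.
- exact: ler01.
- by move=> x; exact: expR_ge0.
- by move=> B mB; rewrite mul1e; apply: esym; exact: stdX.
transitivity (\int[lebesgue_measure]_x
    ((expR (a ^+ 2 / 2))%:E * (normal_pdf a 1 x)%:E)).
  apply: eq_integral => x _; rewrite -EFinM !normal_pdfE ?oner_neq0//.
  congr EFin; rewrite /normal_fun /idR -mulrA -expRD [RHS]mulrCA -expRD.
  by congr (_ * expR _)%R; field.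
rewrite ge0_integralZl_EFin//; last 2 first.
- by move=> x _; rewrite lee_fin normal_pdf_ge0.
- by apply/measurable_EFinP; exact: measurable_normal_pdf.
by rewrite integral_normal_pdf mule1.
Qed.

Lemma integral_expR_gaussian_sum {d : measure_display} {T : measurableType d}
    {R : realType} {P : probability T R} {I : finType} {J : {set I}}
    {X : I -> {RV P >-> R}} (a : I -> R) :
  mutually_independent J X -> (forall i, i \in J -> standard_normal (X i)) ->
  \int[P]_w (expR (\sum_(i in J) a i * X i w))%:E =
  (expR (\sum_(i in J) a i ^+ 2 / 2))%:E.
Proof.
move=> indep stdX.
under eq_integral do rewrite expR_sum.
rewrite expR_sum.
apply: (independent_integral_prod (f := fun i x => expR (a i * x)) indep).
- by move=> i; apply: measurableT_comp => //; exact: measurable_funM.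
- by move=> i x; exact: expR_ge0.
- by move=> i iJ; exact: standard_normal_mgf (stdX i iJ).
Qed.

End gaussian.

(** * Overlaps and transposition of spin matrices *)

(** Exchanging the two summations carries the strict lower triangle to the strict upper one. *)
Lemma sum_upper_pairs {R : comNzRingType} {M : nat} (F : 'I_M -> 'I_M -> R) :
  (forall i j, F i j = F j i) ->
  \sum_i \sum_j F i j =
  \sum_i F i i + (\sum_(p in upper_pairs M) F p.1 p.2) *+ 2.
Proof.
move=> Fsym.
have upper : \sum_(p in upper_pairs M) F p.1 p.2 =
    \sum_(i < M) \sum_(j < M | (i < j)%N) F i j.
  by rewrite pair_big_dep/=; apply: eq_bigl => p; rewrite inE.
have lower : \sum_(p in upper_pairs M) F p.1 p.2 =
    \sum_(i < M) \sum_(j < M | (j < i)%N) F i j.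
  rewrite upper (exchange_big_dep xpredT)//=.
  by apply: eq_bigr => i _; apply: eq_bigr => j _.
rewrite mulr2n {1}upper lower -!big_split/=; apply: eq_bigr => i _.
rewrite (bigD1 i)//=; congr (_ + _).
rewrite (bigID (fun j : 'I_M => (i < j)%N))/=; congr (_ + _).
  by apply: eq_bigl => j; rewrite -val_eqE; case: ltngtP.
by apply: eq_bigl => j; rewrite -val_eqE; case: ltngtP.
Qed.

(** The squared Frobenius norm of [A^T A], where row [l] of [A] is the spin vector of replica
    [S l]. *)
Definition total_overlap (R : realType) {M n : nat}
    (S : {ffun 'I_n -> {ffun 'I_M -> bool}}) : R :=
  \sum_(i < M) \sum_(j < M) (\sum_(l < n) spin R (S l) i * spin R (S l) j) ^+ 2.

(** Spins square to 1, so each of the [M] diagonal overlaps is [n]; they account for the subtracted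
    term. *)
Lemma overlap_upper_pairs (R : realType) {M n : nat}
    (S : {ffun 'I_n -> {ffun 'I_M -> bool}}) :
  (\sum_(p in upper_pairs M)
     (\sum_(l < n) spin R (S l) p.1 * spin R (S l) p.2) ^+ 2) *+ 2 =
  total_overlap R S - M%:R * n%:R ^+ 2.
Proof.
rewrite /total_overlap sum_upper_pairs; last first.
  by move=> i j; congr (_ ^+ 2); apply: eq_bigr => l _; exact: mulrC.
rewrite [X in _ = X + _ - _](eq_bigr (fun=> n%:R ^+ 2)); last first.
  move=> i _; rewrite (eq_bigr (fun=> 1)) ?sumr_const ?card_ord// => l _.
  by rewrite /spin -expr2 sqrr_sign.
by rewrite sumr_const card_ord -[_ ^+ 2 *+ M]mulr_natl addrAC subrr add0r.
Qed.

Definition transpose {M n : nat} (S : {ffun 'I_n -> {ffun 'I_M -> bool}}) :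
    {ffun 'I_M -> {ffun 'I_n -> bool}} := [ffun i => [ffun l => S l i]].

Lemma transposeK {M n : nat} : cancel (@transpose M n) (@transpose n M).
Proof. by move=> S; apply/ffunP => l; apply/ffunP => i; rewrite !ffunE. Qed.

(** Once the squares are expanded, both sides sum the same products of four spins over two sites and
    two replicas, in different orders. *)
Lemma total_overlap_transpose (R : realType) {M n : nat}
    (S : {ffun 'I_n -> {ffun 'I_M -> bool}}) :
  total_overlap R (transpose S) = total_overlap R S.
Proof.
rewrite /total_overlap.
have spinT i l : spin R (transpose S i) l = spin R (S l) i.
  by rewrite /spin !ffunE.
under eq_bigr => l _ do under eq_bigr => m _ do
  rewrite expr2 big_distrlr/=.
under [RHS]eq_bigr => i _ do under eq_bigr => j _ do
  rewrite expr2 big_distrlr/=.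
(* Four exchanges take the summation order [l, m, i, j] to [i, j, l, m]. *)
under eq_bigr do rewrite exchange_big/=.
rewrite exchange_big/=.
under eq_bigr => i _.
  under eq_bigr do rewrite exchange_big/=.
  rewrite exchange_big/=.
  over.
apply: eq_bigr => i _; apply: eq_bigr => j _; apply: eq_bigr => l _.
by apply: eq_bigr => m _; rewrite !spinT; ring.
Qed.

(** * Moments of the partition function *)

Section moments.
Local Open Scope ereal_scope.

(** Distributing the product of [n] sums picks one configuration per factor, that is, a family [S]
    of replicas; the exponents are then regrouped by coupling. *)
Lemma partition_function_expE {d : measure_display} {T : measurableType d}
    {R : realType} {P : probability T R} {M : nat}
    (g : 'I_M * 'I_M -> {RV P >-> R}) (gamma : R) (n : nat) (w : T) :
  (partition_function g gamma w ^+ n =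
   \sum_(S : {ffun 'I_n -> {ffun 'I_M -> bool}})
     expR (\sum_(p in upper_pairs M)
       (gamma / Num.sqrt M%:R *
        \sum_(l < n) spin R (S l) p.1 * spin R (S l) p.2) * g p w))%R.
Proof.
rewrite -[in LHS](card_ord n) -prodr_const /partition_function bigA_distr_bigA/=.
apply: eq_bigr => S _; rewrite -expR_sum -mulr_sumr; congr expR.
under [RHS]eq_bigr do rewrite -mulrA.
rewrite -mulr_sumr; congr (_ * _)%R.
under eq_bigr do rewrite pair_big_dep/=.
rewrite exchange_big/=; apply: eq_big => [p|[i j] _]; first by rewrite inE.
by rewrite mulr_suml; apply: eq_bigr => l _ /=; ring.
Qed.

(** The shift [delta] lets one computation serve both identities: it is 0 in the first and
    [beta ^+ 2 / 4] in the second. *)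
Lemma scaled_partition_function_moment {d : measure_display} {T : measurableType d}
    {R : realType} {P : probability T R} {M : nat}
    {g : 'I_M * 'I_M -> {RV P >-> R}} (delta gamma : R) (n : nat) :
  gaussian_couplings g ->
  'E_P[(fun w => (expR delta * partition_function g gamma w) ^+ n)%R] =
  (\sum_(S : {ffun 'I_n -> {ffun 'I_M -> bool}})
    expR (delta * n%:R +
          gamma ^+ 2 / (4 * M%:R) * (total_overlap R S - M%:R * n%:R ^+ 2)))%:E.
Proof.
move=> [indep stdg]; rewrite unlock.
pose c (S : {ffun 'I_n -> {ffun 'I_M -> bool}}) (p : 'I_M * 'I_M) : R :=
  (gamma / Num.sqrt M%:R *
   \sum_(l < n) spin R (S l) p.1 * spin R (S l) p.2)%R.
transitivity (\int[P]_w (\sum_(S : {ffun 'I_n -> {ffun 'I_M -> bool}})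
    ((expR (delta * n%:R))%:E *
     (expR (\sum_(p in upper_pairs M) c S p * g p w)%R)%:E))).
  apply: eq_integral => w _.
  rewrite exprMn partition_function_expE -expRM_natr mulr_sumr -sumEFin.
  by apply: eq_bigr => S _; rewrite -EFinM.
have mexp S : measurable_fun [set: T]%classic
    (fun w => (expR (\sum_(p in upper_pairs M) c S p * g p w)%R)%:E).
  apply/measurable_EFinP; apply: measurableT_comp => //.
  under eq_fun do rewrite -big_enum/=.
  by apply: measurable_sum => p; exact: measurable_funM.
rewrite ge0_integral_sum//; last first.
  by move=> S; exact: measurable_funeM.
rewrite -sumEFin; apply: eq_bigr => S _.
rewrite ge0_integralZl_EFin// ?expR_ge0//.
rewrite (integral_expR_gaussian_sum (c S) indep stdg) -EFinM -expRD.
(* Each pair contributes its squared overlap times [gamma ^+ 2 / (2 * M)]; the doubling in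
   [overlap_upper_pairs] accounts for the 4. *)
congr (expR (_ + _))%:E; rewrite -overlap_upper_pairs mulrnAr -mulrnAl.
rewrite mulr_sumr; apply: eq_bigr => p _.
rewrite /c exprMn expr_div_n sqr_sqrtr ?ler0n// invfM.
(* Treating the inverse of [M] as an atom spares [field] the condition that [M] is nonzero, which is
   not assumed here. *)
set x := (\sum_(l < n) _)%R; set y := (M%:R^-1)%R; by field.
Qed.

Lemma partition_function_moment {d : measure_display} {T : measurableType d}
    {R : realType} {P : probability T R} {M : nat}
    {g : 'I_M * 'I_M -> {RV P >-> R}} (gamma : R) (n : nat) :
  gaussian_couplings g ->
  'E_P[(fun w => partition_function g gamma w ^+ n)%R] =
  (\sum_(S : {ffun 'I_n -> {ffun 'I_M -> bool}})
    expR (gamma ^+ 2 / (4 * M%:R) * (total_overlap R S - M%:R * n%:R ^+ 2)))%:E.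
Proof.
move=> hg; have := scaled_partition_function_moment 0 gamma n hg.
under eq_fun do rewrite expR0 mul1r.
by under [in RHS]eq_bigr do rewrite mul0r add0r.
Qed.

End moments.

(** * Exchange of system size and moment order *)

Theorem proposition1p1 (R : realType) (beta : R) (N k : nat)
    (d d' : measure_display) (T : measurableType d) (T' : measurableType d')
    (P : probability T R) (P' : probability T' R)
    (g : 'I_N * 'I_N -> {RV P >-> R}) (g' : 'I_k * 'I_k -> {RV P' >-> R})
    (hbeta : 0 < beta) (hN : (2 <= N)%N) (hk : (2 <= k)%N)
    (hg : gaussian_couplings g) (hg' : gaussian_couplings g') :
  ('E_P[(fun w => partition_function g beta w ^+ k)%R] =
     (expR (beta ^+ 2 * k%:R / 4 * N%:R - beta ^+ 2 * k%:R ^+ 2 / 4))%:E *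
     'E_P'[(fun w => partition_function g'
                      (beta * Num.sqrt (k%:R / N%:R)) w ^+ N)%R])%E
  /\
  ('E_P[(fun w => (expR (beta ^+ 2 / 4) *
                  partition_function g (beta / Num.sqrt k%:R) w) ^+ k)%R] =
   'E_P'[(fun w => (expR (beta ^+ 2 / 4) *
                   partition_function g' (beta / Num.sqrt N%:R) w) ^+ N)%R])%E.
Proof.
have N0 : N%:R != 0 :> R by rewrite pnatr_eq0; case: N hN {g hg}.
have k0 : k%:R != 0 :> R by rewrite pnatr_eq0; case: k hk {g' hg'}.
split.
  rewrite (partition_function_moment _ _ hg) (partition_function_moment _ _ hg').
  rewrite -EFinM mulr_sumr; congr EFin.
  (* Transposition matches [k] replicas of size [N] with [N] replicas of size [k]. *)
  rewrite (reindex _ (onW_bij _ (Bijective transposeK transposeK)))/=.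
  apply: eq_bigr => S _; rewrite -expRD total_overlap_transpose; congr expR.
  (* The overlap has coefficient [beta ^+ 2 / (4 * N)] on both sides; the prefactor makes up for the
     differing constants. *)
  rewrite exprMn sqr_sqrtr ?divr_ge0//.
  by field; rewrite N0 k0.
rewrite (scaled_partition_function_moment _ _ _ hg) (scaled_partition_function_moment _ _ _ hg').
congr EFin.
rewrite (reindex _ (onW_bij _ (Bijective transposeK transposeK)))/=.
apply: eq_bigr => S _; rewrite total_overlap_transpose; congr expR.
(* The shift cancels the constant term, which leaves [beta ^+ 2 / (4 * N * k)] times the overlap on
   both sides. *)
rewrite !expr_div_n !sqr_sqrtr//.
by field; rewrite N0 k0.
Qed.
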